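(* Let $G$ be a $3$-connected cubic planar graph, and let $H_1$ and $H_2$ be twisted subgraphs of $G^{\ast}$ inducing strong embeddings of $G$. The two strong embeddings of $G$ defined by $H_1$ and $H_2$ are isomorphic if and only if $H_1$ and $H_2$ lie in the same $\mathrm{Aut}(G^{\ast})$-orbit.
   Context: The graph $G$ is undirected, connected, simple and finite. $G^{\ast}$ is the dual graph of the (unique) embedding of $G$ on the sphere; each edge $e$ of $G$ corresponds to a dual edge $e^{\ast}$ of $G^{\ast}$. An embedding of a graph on a surface (compact $2$-manifold without boundary; all embeddings are cellular, i.e. all cells are open discs) is described combinatorially by a rotation system (a cyclic ordering of the edges at each vertex) together with a signature $\lambda:E(G)\to\{-1,1\}$; the edges with $\lambda(e)=-1$ are called twisted, and the facial walks are obtained by the usual face traversal algorithm, in which crossing a twisted edge switches between clockwise and anticlockwise use of the rotations. Given a subgraph $H$ of $G^{\ast}$, the embedding of $G$ defined (induced) by $H$ is the one with the rotation system of the planar embedding of $G$ and with signature $\lambda'$ satisfying $\lambda'(e)=-1$ if and only if $e^{\ast}\in E(H)$; $H$ is then called a twisted subgraph of $G^{\ast}$. An embedding is strong if all facial walks are cycles (facial cycles). Two strong embeddings of $G$ are isomorphic if and only if their sets of facial cycles lie in the same orbit under the action of the automorphism group $\mathrm{Aut}(G)$. The orbit of a subgraph $H$ of $G^{\ast}$ under $\mathrm{Aut}(G^{\ast})$ is the set of all subgraphs $H'$ with $V(H')=\varphi(V(H))$ and $E(H')=\varphi(E(H))$ for some $\varphi\in\mathrm{Aut}(G^{\ast})$,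 where $\varphi(\{v,w\})=\{\varphi(v),\varphi(w)\}$.
   Formalization: The twisted subgraphs H_1 and H_2 are assumed to have no isolated vertices; otherwise the claim fails, e.g. for K_4 with edgeless H_1, H_2 having one and two vertices, which define the same embedding but lie in different orbits. *)

(* Defs.v *)
From mathcomp Require Import all_boot all_fingroup.
Set Implicit Arguments.
Unset Strict Implicit.
Unset Printing Implicit Defensive.

Record sgraph := SGraph {
  svertex :> finType;
  sedge : rel svertex;
  sedge_sym : symmetric sedge;
  sedge_irrefl : irreflexive sedge
}.

Section Graphs.
Variable G : sgraph.

Definition edges : {set {set G}} :=
  [set [set p.1; p.2] | p : G * G & sedge p.1 p.2].

Definition cubic : Prop := forall x : G, #|[set y | sedge x y]| = 3.

Definition connected_off (S : {set G}) : Prop :=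
  forall x y, x \notin S -> y \notin S ->
    connect [rel u v | [&& u \notin S, v \notin S & sedge u v]] x y.

Definition k_connected (k : nat) : Prop :=
  k < #|G| /\ forall S : {set G}, #|S| < k -> connected_off S.

Definition graph_aut : {set {perm G}} :=
  [set p : {perm G} | [forall x, forall y, sedge (p x) (p y) == sedge x y]].

Definition is_cycle (c : seq G) : bool :=
  [&& 2 < size c, path.cycle (@sedge G) c & uniq c].

Record subgraph := Subgraph {
  sub_vertices : {set G};
  sub_edges : {set {set G}};
  sub_edges_in : sub_edges \subset edges;
  sub_edges_ends : forall e, e \in sub_edges -> e \subset sub_vertices
}.

(* Holds for a subgraph spanned by its edges.  Twisted subgraphs are such:    *)
(* the induced signature depends on the edges only, so that isolated vertices *)
(* would be visible to [same_aut_orbit] but not to the embedding.             *)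
Definition no_isolated_vertex (H : subgraph) : Prop :=
  forall x, x \in sub_vertices H -> exists2 e, e \in sub_edges H & x \in e.

Definition same_aut_orbit (H1 H2 : subgraph) : Prop :=
  exists2 p : {perm G}, p \in graph_aut &
    sub_vertices H2 = p @: sub_vertices H1 /\
    sub_edges H2 = [set p @: (e : {set G}) | e in sub_edges H1].

(* A dart is an edge together with a direction, from tail to head. *)
Definition dart : Type := {d : G * G | sedge d.1 d.2}.

Definition dtail (d : dart) : G := (val d).1.
Definition dhead (d : dart) : G := (val d).2.
Definition edge_of (d : dart) : {set G} := [set dtail d; dhead d].

Lemma drev_subproof (d : dart) : sedge (dhead d) (dtail d).
Proof. by rewrite sedge_sym; exact: (valP d). Qed.

Definition drev (d : dart) : dart :=
  exist (fun p : G * G => sedge p.1 p.2) (dhead d, dtail d) (drev_subproof d).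

Lemma drevK : involutive drev.
Proof. by move=> d; apply: val_inj; rewrite /drev /dhead /dtail /=; case: (val d). Qed.

Definition drev_perm : {perm dart} := perm (inv_inj drevK).

(* The cyclic order of the edges at a vertex is a cyclic permutation of the   *)
(* darts leaving that vertex.                                                 *)
Record rotation_system := RotationSystem {
  vrot :> {perm dart};
  vrotP : forall d, porbit vrot d = [set d' | dtail d' == dtail d]
}.

(* [true] on an edge means that the edge is twisted (sign -1); values outside *)
(* [edges] are irrelevant.                                                    *)
Definition signature : Type := {set G} -> bool.

Section Traversal.
Variables (rho : rotation_system) (lam : signature).

(* In a state (d, b), d is the dart about to be traversed and b tells whether *)
(* the rotations are currently used in the reverse sense.  Each face is       *)
(* traced by two orbits, one for each direction of traversal.                 *)
Definition face_step (x : dart * bool) : dart * bool :=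
  let b := x.2 (+) lam (edge_of x.1) in
  let d := drev x.1 in
  ((if b then (rho : {perm dart})^-1%g d else (rho : {perm dart}) d), b).

Definition facial_walk (x : dart * bool) : seq dart :=
  [seq y.1 | y <- fingraph.orbit face_step x].

Definition strong : Prop := forall x, is_cycle [seq dtail d | d <- facial_walk x].

(* Facial cycles are identified with their edge sets. *)
Definition facial_cycles : {set {set {set G}}} :=
  [set [set edge_of d | d in facial_walk x] | x : dart * bool].

End Traversal.

Definition isomorphic_embeddings
    (rho1 : rotation_system) (lam1 : signature)
    (rho2 : rotation_system) (lam2 : signature) : Prop :=
  exists2 p : {perm G}, p \in graph_aut &
    facial_cycles rho2 lam2 =
    [set [set p @: (e : {set G}) | e in (C : {set {set G}})]
      | C in facial_cycles rho1 lam1].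

Section Dual.
Variable rho : rotation_system.

(* Without twisted edges the traversal never reverses, so that faces are the  *)
(* orbits on darts of d |-> rho (drev d).                                     *)
Definition face_perm : {perm dart} := (drev_perm * rho)%g.

Definition faces : {set {set dart}} := porbits face_perm.

(* Euler's formula for connected graphs. *)
Definition spherical : Prop := #|G| + #|faces| = #|edges| + 2.

Definition dual_vertex : Type := {F : {set dart} | F \in faces}.

Lemma face_of_subproof (d : dart) : porbit face_perm d \in faces.
Proof. exact: imset_f. Qed.

Definition face_of (d : dart) : dual_vertex :=
  exist (fun F => F \in faces) (porbit face_perm d) (face_of_subproof d).

Definition dual_adj : rel dual_vertex := fun F1 F2 =>
  (F1 != F2) && [exists d, (face_of d == F1) && (face_of (drev d) == F2)].

Lemma dual_adj_sym : symmetric dual_adj.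
Proof.
suff imp F1 F2 : dual_adj F1 F2 -> dual_adj F2 F1.
  by move=> F1 F2; apply/idP/idP; exact: imp.
case/andP=> neq /existsP[d /andP[d1 d2]]; rewrite /dual_adj eq_sym neq /=.
by apply/existsP; exists (drev d); rewrite drevK d2 d1.
Qed.

Lemma dual_adj_irrefl : irreflexive dual_adj.
Proof. by move=> F; rewrite /dual_adj eqxx. Qed.

(* When G is 3-connected and rho spherical, the dual has no loops and no      *)
(* parallel edges, so nothing is lost in presenting it as a simple graph.     *)
Definition dual_graph : sgraph := SGraph dual_adj_sym dual_adj_irrefl.

(* The two faces on either side of e, one for each dart of e. *)
Definition dual_edge (e : {set G}) : {set dual_graph} :=
  [set (face_of d : dual_graph) | d : dart & edge_of d == e].

End Dual.
End Graphs.

Definition induced_signature (G : sgraph) (rho : rotation_system G)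
    (H : subgraph (dual_graph rho)) : signature G :=
  fun e => dual_edge rho e \in sub_edges H.

(* Main.v *)
Require Import Defs.
From mathcomp Require Import all_boot all_fingroup all_algebra.
Set Implicit Arguments.
Unset Strict Implicit.
Unset Printing Implicit Defensive.
Import GRing.Theory.

(** Both directions of the equivalence pass through one kind of object: a
    permutation [p] of the vertices of [G] and a permutation [q] of the faces
    of its plane embedding that respect incidence ([incidence_iso]).

    As [G] is cubic, a step of the face traversal can be described by
    incidence alone.  A state amounts to a dart together with one of the two
    faces beside it; crossing a twisted edge replaces that face by the other
    one; the next dart is the one that leaves the head, does not turn back,
    and has the current face beside it.  So [(p, q)] carries the facial cycles
    of a signature to those of the image signature, whether or not [p]
    reverses the rotations ([facial_cycles_image]).  In the other direction,
    the set of facial cycles of a strong embedding determines its signature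
    ([signature_of_facial_cycles]): at each end of an edge [e], a cycle
    through [e] takes exactly one of the two other edges, and which pairs
    occur tells whether [e] is twisted.

    What remains is that each automorphism of [G], and each automorphism of
    the dual graph, belongs to such a pair; this is the uniqueness theorem of
    Whitney and its dual version ([dual_aut_of_graph_aut] and
    [graph_aut_of_dual_aut]).  The topology of the sphere enters only through
    Euler's formula, which says that the complex of faces, edges and vertices
    over the field with two elements is exact in the middle.  This gives the
    Jordan curve theorem in two forms: an edge set that is even around every
    face is a cut ([cocycle_is_cut]), and an edge set that is even at every
    vertex separates two classes of faces ([cycle_is_boundary]).  By the
    first, a loop or a double edge of the dual would be an edge cut of size
    one or two in [G], against 3-connectedness; hence the dual is simple
    ([face_rev_neq], [face_pair_inj]).  Simplicity makes the local structure
    rigid.  The faces at a vertex form a triangle whose removal leaves the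
    dual connected, and by the first form there is no other such triangle, so
    automorphisms of the dual permute these triangles.  Likewise the boundary
    of a face has no chord and its removal leaves [G] connected, and by the
    second form the image of such a boundary under an automorphism of [G] is
    again the boundary of a face. *)

(** * Exactness over the field with two elements *)

Section Homology.
Local Open Scope ring_scope.

(** The left kernel lies in the line of constant vectors. *)
Lemma rank_of_constant_kernel (K : fieldType) m n (A : 'M[K]_(m, n)) :
    (forall u : 'rV_m, u *m A = 0 -> forall i i', u 0 i = u 0 i') ->
  (m <= \rank A + 1)%N.
Proof.
move=> constA; case: m A constA => [|m] A constA //.
have ker1 : (kermx A <= (const_mx 1 : 'rV[K]_m.+1))%MS.
  apply/rV_subP=> u /sub_kermxP uA0; have -> : u = u 0 0 *: const_mx 1.
    by apply/rowP=> i; rewrite !mxE mulr1; exact: constA.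
  exact: scalemx_sub.
have := leq_trans (mxrankS ker1) (rank_leq_row _).
by rewrite mxrank_ker leq_subLR.
Qed.

(** The image of [a] lies in the kernel of [b].  The rank of [a] is at least
    [#|I| - 1] and that of [b] at least [#|L| - 1], so the bound on [#|J|]
    leaves the kernel no room to be larger than the image. *)
Lemma exact_of_dimension (K : fieldType) (I J L : finType)
    (a : I -> J -> K) (b : J -> L -> K) :
    (forall i l, \sum_j a i j * b j l = 0) ->
    (forall x : I -> K, (forall j, \sum_i x i * a i j = 0) ->
       forall i i', x i = x i') ->
    (forall z : L -> K, (forall j, \sum_l b j l * z l = 0) ->
       forall l l', z l = z l') ->
    (#|J| + 2 <= #|I| + #|L|)%N ->
  forall y : J -> K, (forall l, \sum_j y j * b j l = 0) ->
  exists x : I -> K, forall j, y j = \sum_i x i * a i j.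
Proof.
move=> ab0 consta constb dimJ y yb0.
pose A := \matrix_(i < #|I|, j < #|J|) a (enum_val i) (enum_val j).
pose B := \matrix_(j < #|J|, l < #|L|) b (enum_val j) (enum_val l).
have sum_rank (T : finType) (F : T -> K) :
    \sum_(i < #|T|) F (enum_val i) = \sum_t F t.
  by rewrite [RHS](big_enum_val (A := T)).
have AB0 : A *m B = 0.
  apply/matrixP=> i l; rewrite !mxE.
  under eq_bigr do rewrite !mxE.
  by rewrite (sum_rank _ (fun j => a _ j * b j _)).
have rkA : (#|I| <= \rank A + 1)%N.
  apply: rank_of_constant_kernel => u uA0 i i'.
  rewrite -[i]enum_valK -[i']enum_valK.
  apply: (consta (fun t => u 0 (enum_rank t))) => j.
  have /rowP/(_ (enum_rank j)) := uA0; rewrite !mxE; apply: etrans.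
  rewrite -[LHS](sum_rank _ (fun i => u 0 (enum_rank i) * a i j)).
  by apply: eq_bigr => k _; rewrite !mxE enum_valK enum_rankK.
have rkB : (#|L| <= \rank B + 1)%N.
  rewrite -mxrank_tr; apply: rank_of_constant_kernel => u uB0 i i'.
  rewrite -[i]enum_valK -[i']enum_valK.
  apply: (constb (fun t => u 0 (enum_rank t))) => j.
  have /rowP/(_ (enum_rank j)) := uB0; rewrite !mxE; apply: etrans.
  rewrite -[LHS](sum_rank _ (fun i => b j i * u 0 (enum_rank i))).
  by apply: eq_bigr => k _; rewrite !mxE enum_valK enum_rankK mulrC.
have kerB : (kermx B <= A)%MS.
  have AkerB : (A <= kermx B)%MS by apply/sub_kermxP.
  rewrite -(geq_leqif (mxrank_leqif_sup AkerB)) mxrank_ker leq_subLR.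
  rewrite -(leq_add2r 2) (leq_trans dimJ) //.
  by apply: leq_trans (leq_add rkA rkB) _; rewrite addnACA [(\rank B + _)%N]addnC.
pose Y := \row_(j < #|J|) y (enum_val j).
have /submxP[X defY] : (Y <= A)%MS.
  apply: submx_trans kerB; apply/sub_kermxP/rowP=> l; rewrite !mxE.
  under eq_bigr do rewrite !mxE.
  by rewrite (sum_rank _ (fun j => y j * b j _)).
exists (fun i => X 0 (enum_rank i)) => j.
have /rowP/(_ (enum_rank j)) := defY; rewrite !mxE enum_rankK => ->; symmetry.
rewrite -[LHS](sum_rank _ (fun i => X 0 (enum_rank i) * a i j)).
by apply: eq_bigr => k _; rewrite !mxE enum_valK enum_rankK.
Qed.


Section Complex.
Variables (D V E F : finType) (t : D -> V) (e : D -> E) (f : D -> F).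
Variable r : D -> D.
Hypotheses (r_neq : forall d, r d != d).
Hypothesis e_fiber : forall d d', (e d' == e d) = (d' == d) || (d' == r d).

Lemma sum_edge_fiber (g : D -> bool) d :
  \sum_(d' | e d' == e d) g d' = g d (+) g (r d).
Proof.
rewrite (bigD1 d) //= (bigD1 (r d)) /=; last by rewrite e_fiber eqxx orbT r_neq.
rewrite big1 ?addr0 // => d' /andP[/andP[]].
by rewrite e_fiber => /orP[] ->.
Qed.

Lemma sum_incidence (T : finType) (h : D -> T) (P : pred D) (x : T -> bool) :
  \sum_u x u * (\sum_(d | P d) (h d == u)) = \sum_(d | P d) x (h d).
Proof.
under eq_bigr do rewrite mulr_sumr.
rewrite exchange_big /=; apply: eq_bigr => d _.
rewrite (bigD1 (h d)) //= eqxx big1 ?addr0 ?mulr1 // => u.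
by rewrite eq_sym => /negPf->; rewrite mulr0.
Qed.

(** The coefficient of an edge [j] at a vertex [v] is the number modulo 2 of
    darts over [j] that [t] sends to [v], and likewise for [f].  In this form
    vertices and faces play the same part, so that both versions of the Jordan
    curve theorem are instances.  The booleans serve as the field with two
    elements, with [(+)] as addition. *)
Lemma exact_complex :
    (forall v l, \sum_(d | f d == l) ((t d == v) (+) (t (r d) == v)) = 0) ->
    (forall x : V -> bool, (forall d, x (t d) = x (t (r d))) ->
       forall v v', x v = x v') ->
    (forall z : F -> bool, (forall d, z (f d) = z (f (r d))) ->
       forall l l', z l = z l') ->
    (#|E| + 2 <= #|V| + #|F|)%N ->
  forall y : E -> bool, (forall l, \sum_(d | f d == l) y (e d) = 0) ->
  exists x : V -> bool, forall d, y (e d) = x (t d) (+) x (t (r d)).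
Proof.
move=> sq0 constV constF dimE y yf0.
pose a v j := \sum_(d | e d == j) (t d == v).
pose b j l := \sum_(d | f d == l) (e d == j).
have coboundary (x : V -> bool) d :
    \sum_v x v * a v (e d) = x (t d) (+) x (t (r d)).
  by rewrite sum_incidence sum_edge_fiber.
have evenN (c c' : bool) : c (+) c' = 0 -> c = c' by case: c c' => [] [].
have [//||||x defy] := @exact_of_dimension _ _ _ _ a b _ _ _ dimE y.
- move=> v l; rewrite sum_incidence -[RHS](sq0 v l); apply: eq_bigr => d _.
  by rewrite /a (sum_edge_fiber (fun d => t d == v)).
- move=> x x0; apply: constV => d; apply/evenN; rewrite -coboundary; exact: x0.
- move=> z z0; apply: constF => d; apply/evenN.
  rewrite -(sum_edge_fiber (fun d => z (f d))) -[RHS](z0 (e d)).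
  have -> : \sum_(d' | e d' == e d) z (f d') =
      \sum_l z l * (\sum_(d' | e d' == e d) (f d' == l)) by rewrite sum_incidence.
  apply: eq_bigr => l _; rewrite mulrC; congr (_ * _).
  by rewrite big_mkcond [RHS]big_mkcond; apply: eq_bigr => d' _; do 2!case: eqP.
- by move=> l; rewrite sum_incidence.
by exists x => d; rewrite defy coboundary.
Qed.

End Complex.
End Homology.

(** * Connectedness *)

Lemma connect_invariant (U : finType) (X : Type) (e : rel U) (x : U -> X) :
    (forall u v, e u v -> x u = x v) ->
  forall u v, connect e u v -> x u = x v.
Proof.
move=> inv u v /connectP[s]; elim: s u => [|w s IHs] u /= => [_ -> //|].
by case/andP=> /inv-> /IHs/[apply].
Qed.

Lemma connect_homo (U W : finType) (h : U -> W) (e : rel U) (e' : rel W) :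
    {homo h : u v / e u v >-> e' u v} ->
  {homo h : u v / connect e u v >-> connect e' u v}.
Proof.
move=> homo_h u v /connectP[s]; elim: s u => [|w s IHs] u /= => [_ ->|].
  exact: connect0.
by case/andP=> /homo_h/connect1 uw /IHs/[apply]; apply: connect_trans.
Qed.

Lemma aut_connected_off (G : sgraph) (p : {perm G}) (S : {set G}) :
  p \in graph_aut G -> connected_off S -> connected_off (p @: S).
Proof.
rewrite inE => /forallP autp connS x y xS yS.
have imP z : (p z \in p @: S) = (z \in S) by rewrite mem_imset //; apply: perm_inj.
rewrite -[x](permKV p) -[y](permKV p).
rewrite -[x](permKV p) imP in xS; rewrite -[y](permKV p) imP in yS.
apply: connect_homo (connS _ _ xS yS) => u v /=; rewrite !imP.
by have /forallP/(_ v)/eqP-> := autp u.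
Qed.

Lemma mem_porbit1 (U : finType) (s : {perm U}) (x : U) : s x \in porbit s x.
Proof. exact: (mem_porbit s 1). Qed.

Lemma uniq_map_inj (U W : eqType) (h : U -> W) (s : seq U) :
  uniq (map h s) -> {in s &, injective h}.
Proof.
elim: s => //= z s IHs /andP[hz uniqs] x y; rewrite !inE.
case/predU1P=> [->|xs] /predU1P[->|ys] //; last exact: IHs.
  by move=> eq_h; case/negP: hz; rewrite eq_h map_f.
by move=> eq_h; case/negP: hz; rewrite -eq_h map_f.
Qed.

(** * Darts and faces *)

Section Darts.
Variable G : sgraph.

Lemma dart_eq (d d' : dart G) : dtail d = dtail d' -> dhead d = dhead d' -> d = d'.
Proof.
case: d d' => [[u v] uv] [[u' v'] uv']; rewrite /dtail /dhead /= => eu ev.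
by apply: val_inj; rewrite /= eu ev.
Qed.

Lemma dtail_rev (d : dart G) : dtail (drev d) = dhead d. Proof. by []. Qed.
Lemma dhead_rev (d : dart G) : dhead (drev d) = dtail d. Proof. by []. Qed.

Lemma dart_edge (d : dart G) : sedge (dtail d) (dhead d).
Proof. exact: (valP d). Qed.

Lemma tail_neq_head (d : dart G) : dtail d != dhead d.
Proof.
by apply/eqP=> eq_th; have := dart_edge d; rewrite eq_th sedge_irrefl.
Qed.

Lemma dart_of_edge (u v : G) :
  sedge u v -> exists d : dart G, dtail d = u /\ dhead d = v.
Proof. by move=> uv; exists (exist (fun p : G * G => sedge p.1 p.2) (u, v) uv). Qed.

Lemma drev_neq (d : dart G) : drev d != d.
Proof. by apply: contraNneq (tail_neq_head d) => eq_d; rewrite -{1}eq_d. Qed.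

Lemma edge_of_rev (d : dart G) : edge_of (drev d) = edge_of d.
Proof. by rewrite /edge_of setUC. Qed.

Lemma edge_of_eq (d d' : dart G) :
  (edge_of d' == edge_of d) = (d' == d) || (d' == drev d).
Proof.
apply/eqP/orP=> [/setP eq_e|[] /eqP-> //]; last exact: edge_of_rev.
have := eq_e (dtail d'); have := eq_e (dhead d'); rewrite !inE !eqxx orbT /=.
move=> /esym/orP[]/eqP hd' /esym/orP[]/eqP td'.
- by have := tail_neq_head d'; rewrite hd' td' eqxx.
- by right; apply/eqP/dart_eq.
- by left; apply/eqP/dart_eq.
by have := tail_neq_head d'; rewrite hd' td' eqxx.
Qed.

Lemma edge_of_in (d : dart G) : edge_of d \in edges G.
Proof. by apply/imsetP; exists (val d) => //; rewrite inE; exact: dart_edge. Qed.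

Lemma edgeP (e : {set G}) : reflect (exists d : dart G, e = edge_of d) (e \in edges G).
Proof.
apply: (iffP imsetP) => [[[u v]]|[d ->]]; last by apply/imsetP/edge_of_in.
by rewrite inE => uv ->; exists (exist (fun p : G * G => sedge p.1 p.2) (u, v) uv).
Qed.

Lemma graph_autE (p : {perm G}) : p \in graph_aut G ->
  forall u v, sedge (p u) (p v) = sedge u v.
Proof.
by rewrite inE => /forallP autp u v; have /forallP/(_ v)/eqP := autp u.
Qed.

Section DartImage.
Variables (p : {perm G}) (autp : p \in graph_aut G).

Lemma dart_image_subproof (d : dart G) : sedge (p (dtail d)) (p (dhead d)).
Proof. by rewrite graph_autE // dart_edge. Qed.

Definition dart_image (d : dart G) : dart G :=
  exist (fun c : G * G => sedge c.1 c.2) (p (dtail d), p (dhead d))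
    (dart_image_subproof d).

Lemma dtail_image d : dtail (dart_image d) = p (dtail d). Proof. by []. Qed.
Lemma dhead_image d : dhead (dart_image d) = p (dhead d). Proof. by []. Qed.

Lemma dart_image_rev d : dart_image (drev d) = drev (dart_image d).
Proof. exact: dart_eq. Qed.

Lemma dart_image_inj : injective dart_image.
Proof.
by move=> d d' eq_d; apply: dart_eq; apply: (@perm_inj _ p);
  rewrite -?dtail_image -?dhead_image eq_d.
Qed.

Lemma edge_of_image d : edge_of (dart_image d) = p @: edge_of d.
Proof. by rewrite /edge_of imsetU1 imset_set1. Qed.

End DartImage.

End Darts.

Section Map.
Variables (G : sgraph) (rho : rotation_system G).
Local Notation T := (dual_graph rho).
Local Notation f := (face_of rho : dart G -> T).

Lemma dtail_rot d : dtail (rho d) = dtail d.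
Proof.
by have := mem_porbit1 rho d; rewrite vrotP inE => /eqP.
Qed.

Lemma face_perm_rev d : face_perm rho d = rho (drev d).
Proof. by rewrite permM permE. Qed.

Lemma face_of_eq d d' : (f d == f d') = (d' \in porbit (face_perm rho) d).
Proof.
by rewrite -(inj_eq val_inj) /= eq_porbit_mem porbit_sym.
Qed.

Lemma face_of_step d : f (rho (drev d)) = f d.
Proof. by apply/eqP; rewrite face_of_eq -face_perm_rev porbit_sym mem_porbit1. Qed.

(** The two faces beside [d] are [f d] and the face of the next dart at the
    same vertex. *)
Lemma face_of_rev d : f (drev d) = f (rho d).
Proof. by rewrite -(face_of_step (drev d)) drevK. Qed.

Lemma face_of_surj (F : T) : exists d, F = f d.
Proof. by case/imsetP: (valP F) => d _ defF; exists d; apply: val_inj. Qed.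

Lemma face_of_iter d d' : f d = f d' -> exists n, d' = iter n (face_perm rho) d.
Proof.
move/eqP; rewrite face_of_eq => /porbitP[n ->]; exists n.
by rewrite permX.
Qed.

Lemma face_of_iterE n d : f (iter n (face_perm rho) d) = f d.
Proof. by elim: n => //= n; rewrite face_perm_rev face_of_step. Qed.

Lemma dual_edge_of d : dual_edge rho (edge_of d) = [set f d; f (drev d)].
Proof.
apply/setP=> F; rewrite !inE; apply/imsetP/orP.
  case=> d'; rewrite inE edge_of_eq => /orP[]/eqP-> ->; rewrite eqxx; by [left|right].
by case=> /eqP->; [exists d | exists (drev d)]; rewrite ?inE ?edge_of_rev ?eqxx.
Qed.

Lemma dual_adjP (F F' : T) :
  reflect (F <> F' /\ exists2 d, f d = F & f (drev d) = F') (sedge F F').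
Proof.
apply: (iffP andP) => [[/eqP neqF]|[/eqP neqF [d fd frd]]].
  by case/existsP=> d /andP[/eqP fd /eqP frd]; split=> //; exists d.
by split=> //; apply/existsP; exists d; rewrite -fd -frd !eqxx.
Qed.

(** * The Jordan curve theorem from Euler's formula *)

Section Sphere.
Hypotheses (connG : connected_off (set0 : {set G})) (sphG : spherical rho).
Hypothesis has_dart : forall v : G, exists d : dart G, dtail d = v.

Lemma graph_invariant (X : Type) (x : G -> X) :
  (forall d : dart G, x (dtail d) = x (dhead d)) -> forall u v, x u = x v.
Proof.
move=> invx u v.
apply: (connect_invariant _ (connG _ _)); rewrite ?inE //.
by move=> u' v' /and3P[_ _ /dart_of_edge[d [<- <-]]].
Qed.

(** The faces of consecutive darts at a vertex lie on both sides of an edge, so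
    [x] takes one value around each vertex; the connectedness of [G] then
    applies to that value. *)
Lemma face_invariant (X : Type) (x : T -> X) :
  (forall d, x (f d) = x (f (drev d))) -> forall F F', x F = x F'.
Proof.
move=> invx.
have same_tail d d' : dtail d = dtail d' -> x (f d) = x (f d').
  move=> eq_t; have: d' \in porbit rho d by rewrite vrotP inE eq_t.
  case/porbitP=> n ->; rewrite permX; elim: n => //= n ->.
  by rewrite invx face_of_rev.
have dartAt v : exists d : dart G, dtail d == v.
  by have [d <-] := has_dart v; exists d.
pose y v := x (f (xchoose (dartAt v))).
have yE d : y (dtail d) = x (f d).
  by apply: same_tail; apply/eqP/(xchooseP (dartAt _)).
have consty := @graph_invariant X y _.
move=> F F'; have [[d ->] [d' ->]] := (face_of_surj F, face_of_surj F').
rewrite -!yE; apply: consty => c; rewrite -dtail_rev !yE; exact: invx.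
Qed.

Local Open Scope ring_scope.

(** Euler's formula counts [edges G], so the middle term of the complex has to
    be indexed by a type of exactly that size. *)
Definition bundled_edge (d : dart G) : {e | e \in edges G} :=
  exist _ (edge_of d) (edge_of_in d).

(** A face is a closed walk: it enters each vertex as often as it leaves it. *)
Lemma incidence_square (v : G) (F : T) :
  \sum_(d | f d == F) ((dtail d == v) (+) (dtail (drev d) == v)) = 0.
Proof.
rewrite big_split /= (reindex_inj (@perm_inj _ (face_perm rho))) /=.
have -> : \sum_(d | f (face_perm rho d) == F) (dtail (face_perm rho d) == v) =
   \sum_(d | f d == F) (dtail (drev d) == v).
  by apply: eq_big => d; rewrite face_perm_rev ?face_of_step ?dtail_rot.
exact: addbb.
Qed.

(** Dual form of the Jordan curve theorem: the edges dual to an even subgraph of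
    the dual graph are those between [x] and its complement. *)
Lemma cocycle_is_cut (y : {set G} -> bool) :
    (forall F : T, \sum_(d | f d == F) y (edge_of d) = 0) ->
  exists x : G -> bool, forall d, y (edge_of d) = x (dtail d) (+) x (dhead d).
Proof.
move=> y0.
apply: (@exact_complex _ _ {e | e \in edges G} _ (@dtail G) bundled_edge f (@drev G)
  (@drev_neq G) _ _ _ _ _ (fun e => y (val e)) y0).
- by move=> d d'; rewrite -edge_of_eq.
- exact: incidence_square.
- by move=> x; apply: graph_invariant.
- by move=> z; apply: face_invariant.
by rewrite !card_sig; rewrite -[X in (X <= _)%N]sphG.
Qed.

(** Jordan curve theorem: an even subgraph of [G] is the common boundary of two
    complementary sets of faces. *)
Lemma cycle_is_boundary (y : {set G} -> bool) :
    (forall v : G, \sum_(d : dart G | dtail d == v) y (edge_of d) = 0) ->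
  exists x : T -> bool, forall d, y (edge_of d) = x (f d) (+) x (f (drev d)).
Proof.
move=> y0.
apply: (@exact_complex _ _ {e | e \in edges G} _ f bundled_edge (@dtail G) (@drev G)
  (@drev_neq G) _ _ _ _ _ (fun e => y (val e)) y0).
- by move=> d d'; rewrite -edge_of_eq.
- move=> F v; rewrite big_split /= (reindex_inj (@perm_inj _ rho)) /=.
  under eq_bigl do rewrite dtail_rot.
  by under [X in _ + X]eq_bigr do rewrite face_of_rev; exact: addbb.
- by move=> z; apply: face_invariant.
- by move=> x; apply: graph_invariant.
by rewrite !card_sig [X in (_ <= X)%N]addnC; rewrite -[X in (X <= _)%N]sphG.
Qed.

End Sphere.

End Map.

(** * Cubic maps *)

Section Cubic.
Variables (G : sgraph) (rho : rotation_system G).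
Local Notation T := (dual_graph rho).
Local Notation f := (face_of rho : dart G -> T).
Hypothesis cubG : cubic G.

Lemma card_porbit_rot (d : dart G) : #|porbit rho d| = 3.
Proof.
rewrite vrotP -(cubG (dtail d)) -(@card_in_imset _ _ (@dhead G)).
  apply: eq_card => v; rewrite inE; apply/imsetP/idP => [[d']|/dart_of_edge[d' [td' <-]]].
    by rewrite inE => /eqP<- ->; exact: dart_edge.
  by exists d'; rewrite ?inE ?td'.
by move=> d1 d2; rewrite !inE => /eqP t1 /eqP t2; apply: dart_eq; rewrite t1 t2.
Qed.

Lemma rot3 (d : dart G) : rho (rho (rho d)) = d.
Proof. by have := iter_porbit rho d; rewrite card_porbit_rot. Qed.

Lemma rotV (d : dart G) : (rho : {perm dart G})^-1%g d = rho (rho d).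
Proof. by rewrite -{1}[d]rot3 permK. Qed.

Lemma rot_neq (d : dart G) : rho d != d.
Proof.
by have := uniq_traject_porbit rho d; rewrite card_porbit_rot /= !inE eq_sym;
   case/andP => /norP[].
Qed.

Lemma rot2_neq (d : dart G) : rho (rho d) != d.
Proof. by rewrite -{2}[d]rot3 eq_sym rot_neq. Qed.

Lemma same_tail (d d' : dart G) :
  dtail d' = dtail d -> [\/ d' = d, d' = rho d | d' = rho (rho d)].
Proof.
move=> eq_t; have: d' \in porbit rho d by rewrite vrotP inE eq_t.
rewrite porbit_traject card_porbit_rot /= !inE.
by case/or3P => /eqP; [constructor 1|constructor 2|constructor 3].
Qed.

Lemma has_dart (v : G) : exists d : dart G, dtail d = v.
Proof.
have /card_gt0P[w] : 0 < #|[set w | sedge v w]| by rewrite cubG.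
by rewrite inE => /dart_of_edge[d [<- _]]; exists d.
Qed.

End Cubic.

(** * Three-connectedness makes the dual simple *)

Section SmallCuts.
Variable G : sgraph.
Hypotheses (conn3 : k_connected G 3) (cubG : cubic G) (rho : rotation_system G).

(** The tails of [a1] and [a2] would separate the rest of [A] from the head of
    [a1].  That rest is not empty: otherwise every edge at the tail of [a1]
    other than [a1] would be [a2] or lead to the tail of [a2], which leaves no
    place for a third edge. *)
Lemma no_two_edge_cut (A : {set G}) (a1 a2 : dart G) :
    dtail a1 \in A -> dhead a1 \notin A -> dtail a2 \in A ->
    (forall d : dart G, dtail d \in A -> dhead d \notin A -> d = a1 \/ d = a2) ->
  False.
Proof.
move=> t1A h1A t2A cutA; have [_ connS] := conn3.
have cardS : #|[set dtail a1; dtail a2]| < 3 by rewrite cards2; case: eqP.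
have {cardS}connS := connS _ cardS.
have h1S : dhead a1 \notin [set dtail a1; dtail a2].
  by apply: contra h1A; rewrite !inE => /orP[]/eqP->.
have [w wA wS] : exists2 w, w \in A & w \notin [set dtail a1; dtail a2].
  apply/exists_inP; apply: contraT; rewrite negb_exists_in => /forall_inP AS.
  (* Assume that [A] has no other vertex: the edges at [dtail a1] are then
     [a1] and at most one more. *)
  have near1 d : dtail d = dtail a1 -> d != a1 -> d = a2 \/ dhead d = dtail a2.
    move=> td da1; case: (boolP (dhead d \in A)) => [/AS|hdA].
      rewrite negbK !inE => /orP[]/eqP hd; last by right.
      by have := tail_neq_head d; rewrite td hd eqxx.
    have [] := cutA d _ hdA; first by rewrite td.
      by move/eqP; rewrite (negPf da1).
    by left.
  have ta2 : dtail (rho a1) = dtail a1 by exact: dtail_rot.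
  have ta3 : dtail (rho (rho a1)) = dtail a1 by rewrite !dtail_rot.
  have neq23 : rho (rho a1) != rho a1 by rewrite rot_neq.
  have [e2|e2] := near1 _ ta2 (rot_neq rho cubG _).
    have [e3|e3] := near1 _ ta3 (rot2_neq rho cubG _).
      by move: neq23; rewrite e3 e2 eqxx.
    have := tail_neq_head (rho (rho a1)); rewrite e3 !dtail_rot -e2.
    by rewrite dtail_rot eqxx.
  have [e3|e3] := near1 _ ta3 (rot2_neq rho cubG _).
    have := tail_neq_head (rho a1); rewrite e2 -e3.
    by rewrite !dtail_rot eqxx.
  by case/eqP: neq23; apply: dart_eq; rewrite ?e3 ?e2 ?ta3 ?ta2.
have := connect_invariant (x := fun u => u \in A) _ (connS _ _ wS h1S).
rewrite wA (negPf h1A) => imp; suff: true = false by []; apply: imp => u v.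
have stay u' v' : u' \notin [set dtail a1; dtail a2] -> sedge u' v' ->
    u' \in A -> v' \in A.
  move=> u'S /dart_of_edge[d [td hd]] u'A; apply: contraT => v'A.
  by move: u'S; have [] := cutA d; rewrite ?td ?hd // => <-; rewrite td !inE eqxx ?orbT.
case/and3P=> uS vS uv; apply/idP/idP; apply: stay => //.
by rewrite sedge_sym.
Qed.

End SmallCuts.

Section Planar.
Variables (G : sgraph) (rho : rotation_system G).
Local Notation T := (dual_graph rho).
Local Notation f := (face_of rho : dart G -> T).
Hypotheses (conn3 : k_connected G 3) (cubG : cubic G) (sphG : spherical rho).

Lemma conn1 : connected_off (set0 : {set G}).
Proof. by apply: conn3.2; rewrite cards0. Qed.

Local Open Scope ring_scope.

Lemma sum_edge_darts (F : T) (a : dart G) :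
  \sum_(d | f d == F) (edge_of d == edge_of a) = (f a == F) (+) (f (drev a) == F).
Proof.
rewrite big_mkcond.
rewrite -(sum_edge_fiber (@drev_neq G) (@edge_of_eq G) (fun d => f d == F)).
by rewrite [RHS]big_mkcond; apply: eq_bigr => d _; do 2!case: (_ == _).
Qed.

(** The hypothesis says that the dual edges of [s] form an even subgraph. *)
Lemma cut_of_darts (s : seq (dart G)) :
    (forall F : T, \sum_(a <- s) ((f a == F) (+) (f (drev a) == F)) = 0) ->
  exists x : G -> bool, forall d,
    x (dtail d) (+) x (dhead d) = \sum_(a <- s) (edge_of d == edge_of a).
Proof.
move=> s0.
have [F|x xE] := cocycle_is_cut conn1 sphG (has_dart cubG)
  (y := fun e => \sum_(a <- s) (e == edge_of a)).
  by rewrite exchange_big -[RHS](s0 F); apply: eq_bigr => a _; apply: sum_edge_darts.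
by exists x.
Qed.

(** An edge with the same face on both sides would be a bridge. *)
Lemma face_rev_neq d : f d != f (drev d).
Proof.
apply/eqP=> eq_f; have [F|x xE] := cut_of_darts (s := [:: d]).
  by rewrite big_seq1 eq_f; apply: addbb.
have {}xE c : x (dtail c) (+) x (dhead c) = (edge_of c == edge_of d).
  by rewrite xE big_seq1.
apply: (no_two_edge_cut conn3 cubG rho (A := [set v | x v == x (dtail d)])
          (a1 := d) (a2 := d)); rewrite ?inE ?eqxx //.
  by have := xE d; rewrite eqxx; do 2!case: (x _).
move=> c; rewrite !inE => /eqP tc hc.
have: edge_of c == edge_of d by rewrite -xE tc; move: hc; do 2!case: (x _).
rewrite edge_of_eq => /orP[]/eqP eq_c; first by left.
by move: hc; rewrite eq_c dhead_rev eqxx.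
Qed.

(** Two edges between the same two faces would form a cut of size two. *)
Lemma face_pair_inj d d' : f d = f d' -> f (drev d) = f (drev d') -> d = d'.
Proof.
move=> eq_f eq_r; apply/eqP; apply: contraT => neq_d.
have neq_dr : d != drev d'.
  by apply: contraNneq (face_rev_neq d') => eq_d; rewrite -eq_f eq_d.
have [F|x xE] := cut_of_darts (s := [:: d; d']).
  by rewrite big_cons big_seq1 eq_f eq_r; apply: addbb.
have {}xE c : x (dtail c) (+) x (dhead c) =
    (edge_of c == edge_of d) (+) (edge_of c == edge_of d').
  by rewrite xE big_cons big_seq1.
have cutd : x (dtail d) != x (dhead d).
  have := xE d; rewrite eqxx edge_of_eq (negPf neq_d) (negPf neq_dr).
  by do 2!case: (x _).
have neq_dr' : d' != drev d by rewrite -(inj_eq (can_inj (@drevK G))) drevK eq_sym.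
have cutd' : x (dtail d') != x (dhead d').
  have := xE d'; rewrite eqxx edge_of_eq eq_sym (negPf neq_d) (negPf neq_dr').
  by do 2!case: (x _).
(* [no_two_edge_cut] wants both darts to leave the same side of the cut. *)
pose d2 := if x (dtail d') == x (dtail d) then d' else drev d'.
have td2 : x (dtail d2) = x (dtail d).
  rewrite /d2; case: ifP => [/eqP //|]; rewrite dtail_rev.
  by move: cutd'; do 3!case: (x _).
apply: False_ind; apply: (no_two_edge_cut conn3 cubG rho
  (A := [set v | x v == x (dtail d)]) (a1 := d) (a2 := d2));
  rewrite ?inE ?eqxx ?td2 //; first by rewrite eq_sym.
move=> c; rewrite !inE => /eqP tc hc.
have hc' : x (dhead c) != x (dtail c) by rewrite tc.
have: (edge_of c == edge_of d) || (edge_of c == edge_of d').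
  move: hc' (xE c); case: (edge_of c == edge_of d) => //.
  by case: (edge_of c == edge_of d') => //; do 2!case: (x _).
rewrite !edge_of_eq => /orP[/orP[]|] /eqP.
- by left.
- by move=> eq_c; move: hc; rewrite eq_c dhead_rev eqxx.
move=> c_d'; right; rewrite /d2.
have : (c == d') || (c == drev d') by apply/eqP.
case/orP => /eqP eq_c; rewrite -?eq_c ?tc ?eqxx //.
have -> : d' = drev c by rewrite eq_c drevK.
by rewrite dtail_rev (negPf hc).
Qed.

(** * Incidence of vertices and faces *)

Lemma face_rot_neq d : f d != f (rho d).
Proof. by rewrite -face_of_rev face_rev_neq. Qed.

Lemma face_rot2_neq d : f d != f (rho (rho d)).
Proof. by rewrite -{1}[d](rot3 rho cubG) eq_sym face_rot_neq. Qed.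

Lemma face_rev_rot2 d : f (drev (rho (rho d))) = f d.
Proof. by rewrite face_of_rev (rot3 rho cubG). Qed.

Definition incident (v : G) (F : T) := [exists d, (dtail d == v) && (f d == F)].

Lemma incidentP v F : reflect (exists2 d, dtail d = v & f d = F) (incident v F).
Proof.
by apply: (iffP existsP) => [[d /andP[/eqP dv /eqP fF]]|[d dv fF]]; exists d;
  rewrite ?dv ?fF ?eqxx.
Qed.

Lemma incident_face d : incident (dtail d) (f d).
Proof. by apply/incidentP; exists d. Qed.

Lemma incident_rev d : incident (dtail d) (f (drev d)).
Proof. by rewrite face_of_rev -(dtail_rot rho) incident_face. Qed.

Lemma incident_head d : incident (dhead d) (f d).
Proof. by have := incident_rev (drev d); rewrite drevK. Qed.

Lemma incidentE d F :
  incident (dtail d) F = [|| F == f d, F == f (rho d) | F == f (rho (rho d))].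
Proof.
apply/incidentP/or3P => [[d' /(same_tail rho cubG)[->|->|->] <-]|].
- by constructor 1.
- by constructor 2.
- by constructor 3.
by case=> /eqP ->; [exists d | exists (rho d) | exists (rho (rho d))]; rewrite ?dtail_rot.
Qed.

(** Any two of the three faces at a cubic vertex are consecutive there. *)
Lemma edge_of_two_faces v F F' :
    incident v F -> incident v F' -> F != F' ->
  exists2 d, dtail d = v & f d = F /\ f (drev d) = F' \/ f d = F' /\ f (drev d) = F.
Proof.
case/incidentP=> d <- <-; rewrite incidentE => /or3P[]/eqP-> neq.
- by rewrite eqxx in neq.
- by exists d => //; left; rewrite face_of_rev.
by exists (rho (rho d)); rewrite ?dtail_rot // face_rev_rot2; right.
Qed.

(** Face boundaries have no chords.  If [F] met both ends of [d] without lying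
    beside [d], it would be the third face at each of them; the edge between
    [F] and [f d] at one end and the one at the other end would then be the
    same by [face_pair_inj], parallel to the edge of [d]. *)
Lemma incident_both_ends d F :
  incident (dtail d) F && incident (dhead d) F = (F == f d) || (F == f (drev d)).
Proof.
apply/andP/orP=> [[]|[]/eqP->]; last 2 first.
- by rewrite incident_face incident_head.
- by rewrite incident_rev (incident_face (drev d)).
rewrite incidentE -dtail_rev incidentE face_of_step.
rewrite -face_of_rev => /or3P[/eqP->|/eqP->|/eqP defF]; [by left|by right|].
case/or3P => [-> | -> | /eqP defF']; [by right | by left |].
have eq_d : rho (rho d) = drev (rho (drev d)).
  apply: face_pair_inj; first by rewrite face_of_rev -defF -defF'.
  by rewrite drevK face_rev_rot2 face_of_step.
have /eqP[] := rot_neq rho cubG (drev d); apply: dart_eq; first by rewrite dtail_rot.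
by rewrite dhead_rev -(dtail_rev (rho (drev d))) -eq_d !dtail_rot.
Qed.

Lemma incident_vertex_inj u v : (forall F, incident u F = incident v F) -> u = v.
Proof.
move=> eq_uv; apply/eqP; apply: contraT => neq_uv.
have headv d : dtail d = u -> dhead d = v.
  move=> du; have i1 := incident_face d; have i2 := incident_rev d.
  rewrite du !eq_uv in i1 i2.
  have [d' d'v] := edge_of_two_faces i1 i2 (face_rev_neq d).
  case=> [] [e1 e2].
    by case/eqP: neq_uv; rewrite -du -d'v; congr dtail; apply: face_pair_inj.
  suff <- : drev d' = d by rewrite dhead_rev.
  by apply: face_pair_inj; rewrite ?drevK.
have [d du] := has_dart cubG u.
have /eqP[] := rot_neq rho cubG d.
by apply: dart_eq; rewrite ?dtail_rot // !headv // dtail_rot.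
Qed.

Lemma incident_face_inj F F' : (forall v, incident v F = incident v F') -> F = F'.
Proof.
move=> eq_F; apply/eqP; apply: contraT => neq_F.
have other d : f d = F -> F' = f (drev d).
  move=> fd; apply/eqP; have := incident_both_ends d F'.
  rewrite -!eq_F -fd incident_both_ends eqxx /= => /esym.
  by rewrite fd eq_sym (negPf neq_F).
have [d fd] := face_of_surj F; have := face_of_step rho d; rewrite -fd => fd'.
have eq_d : d = rho (drev d) by apply: face_pair_inj; rewrite ?fd' // -!other.
by have := tail_neq_head d; rewrite {1}eq_d dtail_rot eqxx.
Qed.

(** With [dual_edge_by_incidence], this makes every permutation that is part of
    an incidence isomorphism a graph automorphism. *)
Lemma edge_by_incidence u v :
  sedge u v = (u != v) && [exists F, exists F',
    [&& F != F', incident u F, incident u F', incident v F & incident v F']].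
Proof.
apply/idP/andP=> [/dart_of_edge[d [<- <-]]|[neq_uv]].
  rewrite tail_neq_head; split=> //; apply/existsP; exists (f d).
  apply/existsP; exists (f (drev d)); rewrite face_rev_neq incident_face incident_rev.
  by rewrite incident_head (incident_face (drev d)).
case/existsP=> F /existsP[F' /and5P[neqF uF uF' vF vF']].
have [d du dF] := edge_of_two_faces uF uF' neqF.
have [d' dv dF'] := edge_of_two_faces vF vF' neqF.
suff eq_d : d = drev d' by rewrite -du -dv {1}eq_d -dhead_rev drevK sedge_sym dart_edge.
have neq_d : d != d' by apply: contraNneq neq_uv => eq_d; rewrite -du -dv eq_d.
case: dF dF' => [] [e1 e2] [] [e3 e4].
- by case/eqP: neq_d; apply: face_pair_inj; rewrite ?e1 ?e2.
- by apply: face_pair_inj; rewrite ?drevK ?e1 ?e2.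
- by apply: face_pair_inj; rewrite ?drevK ?e1 ?e2.
by case/eqP: neq_d; apply: face_pair_inj; rewrite ?e1 ?e2.
Qed.

Lemma dual_edge_by_incidence (F F' : T) :
  sedge F F' = (F != F') && [exists v, incident v F && incident v F'].
Proof.
apply/dual_adjP/andP=> [[/eqP neqF [d <- <-]]|[neqF /existsP[v /andP[vF vF']]]].
  split; first exact: face_rev_neq.
  by apply/existsP; exists (dtail d); rewrite incident_face incident_rev.
split; first exact/eqP.
have [d dv [[e1 e2]|[e1 e2]]] := edge_of_two_faces vF vF' neqF; first by exists d.
by exists (drev d); rewrite ?drevK.
Qed.

(** * Automorphisms of the dual graph *)

Lemma off_connect_sym (H : sgraph) (S : {set H}) :
  connect_sym [rel u v | [&& u \notin S, v \notin S & sedge u v]].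
Proof.
by apply: sym_connect_sym => u v /=; rewrite sedge_sym andbCA.
Qed.

Definition faces_at (v : G) : {set T} := [set F | incident v F].

Lemma face_across_at c d : f d = f c -> f (drev d) \in faces_at (dtail c) ->
  d = c \/ d = drev (rho (rho c)).
Proof.
move=> eq_f; rewrite inE incidentE => /or3P[]/eqP eq_r.
- by have := face_rev_neq d; rewrite eq_r eq_f eqxx.
- by left; apply: face_pair_inj; rewrite // eq_r face_of_rev.
by right; apply: face_pair_inj; rewrite ?drevK ?face_rev_rot2.
Qed.

(** The face at the head of [c] that does not lie beside [c]. *)
Definition opposite_face c := f (drev (rho (drev c))).

Lemma opposite_face_off c : opposite_face c \notin faces_at (dtail c).
Proof.
apply/negP=> /face_across_at[|eq_c|eq_c]; first by rewrite face_of_step.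
  by have := tail_neq_head c; rewrite -{1}eq_c dtail_rot eqxx.
have /eqP[] := rot_neq rho cubG (drev c).
apply: dart_eq; first by rewrite dtail_rot.
by rewrite eq_c !dhead_rev !dtail_rot.
Qed.

(** The faces met across the successive edges of [f c] are consecutively
    adjacent.  By [face_across_at], of these only the first and the last belong
    to [faces_at (dtail c)], so the others are joined to each other off that
    set. *)
Lemma link_connected c d :
    f d = f c -> f (drev d) \notin faces_at (dtail c) ->
  connect [rel u v : T | [&& u \notin faces_at (dtail c),
                             v \notin faces_at (dtail c) & sedge u v]]
    (opposite_face c) (f (drev d)).
Proof.
set S := faces_at _; set R := (X in connect X) => /esym/face_of_iter[n ->].
elim: n => [|n IHn] /=; first by rewrite inE incident_rev.
set d' := iter n _ c in IHn *; rewrite face_perm_rev => offS.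
have fd' : f d' = f c by exact: face_of_iterE.
case: (boolP (f (drev d') \in S)) => [|offS'].
  case/(face_across_at fd') => eq_d'; first by rewrite eq_d' connect0.
  by move: offS; rewrite eq_d' drevK (rot3 rho cubG) inE incident_rev.
apply: connect_trans (IHn offS') _.
have [-> //|neq] := eqVneq (f (drev d')) (f (drev (rho (drev d')))).
apply: connect1; apply/and3P; split=> //.
rewrite dual_edge_by_incidence neq /=.
apply/existsP; exists (dhead d'); rewrite (incident_face (drev d')).
by rewrite -(dtail_rev d') -(dtail_rot rho) incident_rev.
Qed.

(** By [link_connected], the neighbours of each face at [v] that are not
    themselves at [v] are joined off the triangle, and the three groups so
    obtained are chained by the opposite faces of the edges at [v].  Every
    remaining face reaches one of these groups, as the dual graph is
    connected. *)
Lemma faces_at_nonseparating v : connected_off (faces_at v).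
Proof.
have [c <-] := has_dart cubG v; set S := faces_at _.
pose R := [rel u v : T | [&& u \notin S, v \notin S & sedge u v]].
(* The opposite faces of [d] and of the dart before it are the two ends of the
   part of the link of [f d] that lies off the triangle. *)
have turn d : dtail d = dtail c ->
    connect R (opposite_face d) (opposite_face (rho (rho d))).
  move=> td.
  have -> : opposite_face (rho (rho d)) =
      f (drev (drev (rho (rho (drev (rho (rho d))))))).
    by rewrite drevK /opposite_face face_of_rev.
  rewrite /R /S -td; apply: link_connected; first by rewrite !face_rev_rot2.
  have := opposite_face_off (rho (rho d)).
  by rewrite !dtail_rot /opposite_face face_of_rev drevK.
have all_opp d : dtail d = dtail c -> connect R (opposite_face c) (opposite_face d).
  case/(same_tail rho cubG) => ->; first exact: connect0.
    apply: connect_trans (turn c _) _ => //.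
    by rewrite -{2}[c](rot3 rho cubG); apply: turn; rewrite !dtail_rot.
  exact: turn.
pose x F := (F \in S) || connect R (opposite_face c) F.
have xstep d : x (f d) -> x (f (drev d)).
  rewrite /x; case: (boolP (f (drev d) \in S)) => //= offr.
  case: (boolP (f d \in S)) => [|off]; last first.
  - move=> /connect_trans; apply; apply: connect1; apply/and3P; split=> //.
    apply/dual_adjP; split; last by exists d.
    by apply/eqP/face_rev_neq.
  rewrite inE => /incidentP[c' tc' fc'] _; apply: connect_trans (all_opp _ tc') _.
  by rewrite /R /S -tc'; apply: link_connected => //; rewrite tc'.
have allx F : x F.
  have inv d : x (f d) = x (f (drev d)).
    by apply/idP/idP => [/xstep|/xstep] //; rewrite drevK.
  rewrite (face_invariant conn1 (has_dart cubG) inv F (f c)).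
  by rewrite /x inE incident_face.
move=> F F' offF offF'; have := allx F; have := allx F'.
rewrite /x (negPf offF) (negPf offF') /= => cF'.
by rewrite (@off_connect_sym T S) => /connect_trans; apply.
Qed.

(** A triangle is an even subgraph of the dual, so its edges form a cut of [G].
    The boundary of a face off the triangle crosses no edge of the cut, and
    adjacent faces share vertices, so all faces off the triangle lie on one
    side.  A vertex on the other side meets only the three faces of the
    triangle. *)
Lemma nonseparating_triangle_facial (F1 F2 F3 : T) :
    sedge F1 F2 -> sedge F2 F3 -> sedge F3 F1 ->
    connected_off [set F1; F2; F3] ->
  exists v, faces_at v = [set F1; F2; F3].
Proof.
case/dual_adjP=> neq12 [a fa ra] /dual_adjP[neq23 [b fb rb]].
case/dual_adjP=> neq31 [c fc rc]; set S := [set _; _; _] => connS.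
have [F|x xE] := cut_of_darts (s := [:: a; b; c]).
  rewrite !big_cons big_nil fa ra fb rb fc rc.
  by do 3!case: (_ == F).
have ab : edge_of a != edge_of b.
  apply/negP; rewrite edge_of_eq => /orP[]/eqP eq_d.
    by case: neq12; rewrite -fa eq_d fb.
  by case: neq31; rewrite -fa eq_d rb.
have bc : edge_of b != edge_of c.
  apply/negP; rewrite edge_of_eq => /orP[]/eqP eq_d.
    by case: neq23; rewrite -fb eq_d fc.
  by case: neq12; rewrite -fb eq_d rc.
have ac : edge_of a != edge_of c.
  apply/negP; rewrite edge_of_eq eq_sym => /orP[]/eqP eq_d.
    by case: neq31; rewrite -fc eq_d fa.
  by case: neq23; rewrite -ra eq_d drevK fc.
have {}xE d : x (dtail d) (+) x (dhead d) = [|| edge_of d == edge_of a,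
   edge_of d == edge_of b | edge_of d == edge_of c].
  rewrite xE !big_cons big_nil.
  have [->|_] := eqVneq (edge_of d) (edge_of a).
    by rewrite (negPf ab) (negPf ac).
  have [->|_] := eqVneq (edge_of d) (edge_of b); first by rewrite (negPf bc).
  by case: (_ == _).
have cuta : x (dtail a) != x (dhead a).
  by have := xE a; rewrite eqxx; do 2!case: (x _).
have offcut d : f d \notin S -> x (dtail d) = x (dhead d).
  have edgeS e : f e \in S -> f (drev e) \in S ->
      edge_of d == edge_of e -> f d \in S.
    by move=> eS reS; rewrite edge_of_eq => /orP[]/eqP->.
  move=> offS; have := xE d; case: or3P => [edge_d|_]; last by do 2!case: (x _).
  by case/negP: offS; case: edge_d => /edgeS; apply;
    rewrite ?fa ?ra ?fb ?rb ?fc ?rc !inE eqxx ?orbT.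
(* The side of the cut on which the boundary of [F] lies, for [F] off [S]. *)
pose X F := [exists d, (f d == F) && x (dtail d)].
have XE v F : incident v F -> F \notin S -> x v = X F.
  case/incidentP=> d <- <- offS.
  apply/idP/existsP => [xd|[d' /andP[/eqP fd']]]; first by exists d; rewrite eqxx.
  have [n ->] := face_of_iter (esym fd'); elim: n => //= n IHn.
  rewrite face_perm_rev dtail_rot dtail_rev -offcut //.
  by rewrite face_of_iterE.
have [v vS] : exists v, faces_at v \subset S.
  case: (pickP [pred F | F \notin S]) => [F0 /= F0S|noF]; last first.
    by exists (dtail a); apply/subsetP=> F _; have /negbFE := noF F.
  have [v xv] : exists v, x v != X F0.
    case: (eqVneq (x (dtail a)) (X F0)) => [eqX|]; last by exists (dtail a).
    by exists (dhead a); rewrite -eqX eq_sym.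
  exists v; apply/subsetP=> F; rewrite inE => vF; apply: contraT => FS.
  case/eqP: xv; rewrite (XE v F vF FS).
  apply: (connect_invariant _ (connS _ _ FS F0S)) => F' F'' /and3P[F'S F''S].
  rewrite dual_edge_by_incidence => /andP[_ /existsP[u /andP[uF' uF'']]].
  by rewrite -(XE u F' uF' F'S) (XE u F'' uF'' F''S).
exists v; apply/eqP; rewrite eqEcard vS /=.
have [d dv] := has_dart cubG v.
have -> : faces_at v = [set f d; f (rho d); f (rho (rho d))].
  by apply/setP=> F; rewrite !inE -dv incidentE -orbA.
have card3 (A B C : T) : #|[set A; B; C]| = #|[set A; B]| + (C \notin [set A; B]).
  by rewrite setUC cardsU1 addnC.
rewrite !card3 !cards2 !inE !negb_or face_rot_neq (eq_sym _ (f (rho d))) face_rot_neq.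
rewrite (eq_sym _ (f d)) face_rot2_neq.
by move/eqP: neq12 => ->; case: (_ && _).
Qed.

(** An isomorphism of the plane map with itself, possibly reversing the
    orientation. *)
Definition incidence_iso (p : {perm G}) (q : {perm T}) : Prop :=
  forall v F, incident (p v) (q F) = incident v F.

Lemma incidence_iso_graph_aut p q : incidence_iso p q -> p \in graph_aut G.
Proof.
move=> iso_pq; rewrite inE; apply/forallP=> u; apply/forallP=> v; apply/eqP.
rewrite (edge_by_incidence (p u)) (edge_by_incidence u) (inj_eq perm_inj).
apply: andb_id2l => _.
apply/existsP/existsP=> [] [F /existsP[F']].
  rewrite -[F](permKV q) -[F'](permKV q) !iso_pq (inj_eq perm_inj) => inc.
  by exists (q^-1%g F); apply/existsP; exists (q^-1%g F').
move=> inc; exists (q F); apply/existsP; exists (q F').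
by rewrite !iso_pq (inj_eq perm_inj).
Qed.

Lemma incidence_iso_dual_aut p q : incidence_iso p q -> q \in graph_aut T.
Proof.
move=> iso_pq; rewrite inE; apply/forallP=> F; apply/forallP=> F'; apply/eqP.
rewrite (dual_edge_by_incidence (q F)) (dual_edge_by_incidence F) (inj_eq perm_inj).
apply: andb_id2l => _.
apply/existsP/existsP=> [] [v].
  by rewrite -[v](permKV p) !iso_pq => inc; exists (p^-1%g v).
by move=> inc; exists (p v); rewrite !iso_pq.
Qed.

(** Being a triangle whose removal leaves the dual connected is invariant under
    automorphisms, and it characterizes the sets [faces_at v]. *)
Lemma graph_aut_of_dual_aut q :
  q \in graph_aut T -> exists p, incidence_iso p q.
Proof.
move=> autq.
have ex_v v : exists v', forall F, incident v' (q F) = incident v F.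
  have [d dv] := has_dart cubG v.
  have face3 : faces_at v = [set f d; f (rho d); f (rho (rho d))].
    by apply/setP=> F; rewrite !inE -dv incidentE -orbA.
  have image3 : q @: faces_at v = [set q (f d); q (f (rho d)); q (f (rho (rho d)))].
    by rewrite face3 !imsetU !imset_set1.
  have adj c : sedge (f c) (f (rho c)).
    apply/dual_adjP; split; first by apply/eqP/face_rot_neq.
    by exists c; rewrite ?face_of_rev.
  have [v' eq_v'] : exists v', faces_at v' = q @: faces_at v.
    rewrite image3; apply: nonseparating_triangle_facial; rewrite ?graph_autE //.
      by have := adj (rho (rho d)); rewrite (rot3 rho cubG).
    rewrite -image3; exact: aut_connected_off (@faces_at_nonseparating v).
  exists v' => F; have /setP/(_ (q F)) := eq_v'.
  by rewrite mem_imset ?inE //; apply: perm_inj.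
have [p pE] := fin_all_exists ex_v.
have p_inj : injective p.
  by move=> u v eq_p; apply: incident_vertex_inj => F; rewrite -pE eq_p pE.
by exists (perm p_inj) => v F; rewrite permE pE.
Qed.

(** * Automorphisms of the graph *)

Definition vertices_on (F : T) : {set G} := [set v | incident v F].

(** Since [rho d] is not an edge of the boundary of [f d], it is not a chord of it
    either. *)
Lemma spoke_off d : dhead (rho d) \notin vertices_on (f d).
Proof.
rewrite inE; apply/negP=> onF; have := incident_both_ends (rho d) (f d).
rewrite onF (dtail_rot rho) incident_face (negPf (face_rot_neq d)) face_of_rev /=.
by rewrite (negPf (face_rot2_neq d)).
Qed.

Lemma head_on d : dhead d \in vertices_on (f d).
Proof. by rewrite inE incident_head. Qed.

Lemma back_on d : dhead (rho (rho d)) \in vertices_on (f d).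
Proof. by rewrite inE -(face_rev_rot2 d) (incident_face (drev (rho (rho d)))). Qed.

(** Each boundary vertex of [F] has one further edge, its spoke, which leads off
    the boundary.  The spokes at the two ends of a boundary edge are joined by
    the rest of the boundary of the face beyond that edge, which meets [F] in
    that edge only.  So all spokes lead to the same component, and every vertex
    off the boundary reaches a spoke, as [G] is connected. *)
Lemma face_boundary_nonseparating F : connected_off (vertices_on F).
Proof.
set S := vertices_on F.
pose R := [rel u v : G | [&& u \notin S, v \notin S & sedge u v]].
(* The face beyond [d] meets [F] only in the two ends of [d]. *)
have onFE c d : f d = F -> f c = f (drev d) -> dtail c \in S ->
    c = drev d \/ c = rho d.
  move=> fd fc; rewrite inE incidentE => /or3P[]/eqP eqF.
  - by have := face_rev_neq d; rewrite fd eqF fc eqxx.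
  - by left; apply: face_pair_inj; rewrite ?drevK // face_of_rev -eqF.
  right; rewrite -[c](rot3 rho cubG); congr (rho _).
  by apply: face_pair_inj; rewrite ?face_rev_rot2 ?fd -?eqF.
(* From spoke to spoke; [rho (rho (drev d))] is the spoke at the head of [d]. *)
have next d : f d = F -> connect R (dhead (rho d)) (dhead (rho (rho (drev d)))).
  move=> fd; have walk c : f c = f (drev d) -> dtail c \notin S ->
      connect R (dhead (rho d)) (dtail c).
    rewrite face_of_rev => /esym/face_of_iter[n ->]; elim: n => [|n IHn] /=.
      by rewrite dtail_rot /S -fd inE incident_face.
    set c' := iter n _ _ in IHn *; rewrite face_perm_rev dtail_rot dtail_rev => offh.
    have fc' : f c' = f (drev d) by rewrite face_of_iterE face_of_rev.
    case: (boolP (dtail c' \in S)) => [|offt].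
      case/(onFE _ _ fd fc') => eq_c'; last by rewrite eq_c' connect0.
      by move: offh; rewrite eq_c' dhead_rev /S -fd inE incident_face.
    apply: connect_trans (IHn offt) (connect1 _).
    by apply/and3P; split=> //; exact: dart_edge.
  rewrite -(dtail_rev (rho (rho (drev d)))); apply: walk; first by rewrite face_rev_rot2.
  rewrite dtail_rev /S -fd -[f d](face_of_step rho d); exact: spoke_off.
have [d0 fd0] := face_of_surj F; symmetry in fd0.
have spokes d : f d = F -> connect R (dhead (rho d0)) (dhead (rho d)).
  rewrite -fd0 => /esym/face_of_iter[n ->]; elim: n => [|n IHn]; first exact: connect0.
  rewrite iterS face_perm_rev; apply: connect_trans IHn (next _ _).
  by rewrite face_of_iterE.
pose x u := (u \in S) || connect R (dhead (rho d0)) u.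
have xstep c : x (dtail c) -> x (dhead c).
  rewrite /x; case: (boolP (dhead c \in S)) => //= offh.
  case: (boolP (dtail c \in S)) => [|offt] /=; last first.
    move=> /connect_trans; apply; apply: connect1; apply/and3P; split=> //.
    exact: dart_edge.
  rewrite inE => /incidentP[d td fd] _.
  move: offh; have [-> | -> _ | ->] := same_tail rho cubG (esym td).
  - by rewrite /S -fd head_on.
  - exact: spokes.
  - by rewrite /S -fd back_on.
have allx u : x u.
  have inv c : x (dtail c) = x (dhead c).
    by apply/idP/idP; [exact: xstep | exact: (xstep (drev c))].
  rewrite (graph_invariant conn1 inv u (dtail d0)).
  by rewrite /x /S inE -fd0 incident_face.
move=> u v offu offv; have := allx u; have := allx v.
rewrite /x (negPf offu) (negPf offv) /= => cv cu.
by rewrite (@off_connect_sym G S) in cu; exact: connect_trans cu cv.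
Qed.

Lemma sum_darts_at (g : dart G -> bool) d :
  \sum_(c | dtail c == dtail d) g c = g d (+) (g (rho d) (+) g (rho (rho d))).
Proof.
rewrite (bigD1 d) //= (bigD1 (rho d)) /=; last by rewrite dtail_rot eqxx rot_neq.
rewrite (bigD1 (rho (rho d))) /=; last by rewrite !dtail_rot eqxx rot2_neq ?rot_neq.
rewrite big1 ?addr0 // => c /andP[/andP[/andP[/eqP tc]]].
by have [-> | -> | ->] := same_tail rho cubG tc; rewrite eqxx.
Qed.

(** The image [U] of the boundary of [F] is a cycle without chords whose removal
    leaves [G] connected.  Its edges separate two classes of faces; as no edge
    at a vertex off [U] is crossed, the faces that meet the complement of [U]
    all lie in one class.  A face [F'] of the other class has its whole
    boundary in [U].  Both boundaries are cycles without chords, so they are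
    equal. *)
Lemma face_image p (autp : p \in graph_aut G) F :
  exists F', forall v, incident (p v) F' = incident v F.
Proof.
pose U := p @: vertices_on F.
have UE v : (p v \in U) = incident v F by rewrite mem_imset ?inE //; apply: perm_inj.
have connU := aut_connected_off autp (@face_boundary_nonseparating F).
have evenU v : \sum_(d | dtail d == v) (edge_of d \subset U) = 0.
  rewrite -[v](permKV p) (reindex_inj (dart_image_inj (autp := autp))) /=.
  set u := p^-1%g v; under eq_bigl do rewrite dtail_image (inj_eq perm_inj).
  have [d <-] := has_dart cubG u; rewrite sum_darts_at.
  have subU c : (edge_of (dart_image autp c) \subset U) =
      incident (dtail c) F && incident (dhead c) F.
    by rewrite subUset !sub1set dtail_image dhead_image !UE.
  rewrite !subU !incident_both_ends face_rev_rot2 !face_of_rev.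
  have : f d != f (rho d) := face_rot_neq d.
  have : f (rho d) != f (rho (rho d)) := face_rot_neq (rho d).
  have : f d != f (rho (rho d)) := face_rot2_neq d.
  have [->|_] := eqVneq F (f d).
    by move=> /negPf-> _ /negPf->.
  have [->|_] := eqVneq F (f (rho d)); first by move=> _ /negPf->.
  by move=> _ _ _; case: (F == _).
have [x xE] := cycle_is_boundary conn1 sphG (has_dart cubG)
  (y := fun e : {set G} => e \subset U) evenU.
have [d0 fd0] := face_of_surj F.
(* The class of the faces at [v], for [v] off [U]. *)
pose X v := [exists d, (dtail d == v) && x (f d)].
have XE v F' : v \notin U -> incident v F' -> x F' = X v.
  move=> offU /incidentP[d dv <-]; have same c : dtail c = v -> x (f c) = x (f (rho c)).
    move=> cv; have := xE c; rewrite -face_of_rev subUset sub1set cv (negPf offU) /=.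
    by do 2!case: (x _).
  apply/idP/existsP => [xd|[c /andP[/eqP cv]]]; first by exists d; rewrite dv eqxx.
  rewrite -cv in dv; case: (same_tail rho cubG dv) => -> //.
    by rewrite same.
  by rewrite same // same // dtail_rot.
pose w := p (dhead (rho d0)).
have offw : w \notin U by rewrite UE fd0; have := spoke_off d0; rewrite inE.
have [F' xF'] : exists F', x F' != X w.
  have : edge_of (dart_image autp d0) \subset U.
    rewrite subUset !sub1set dtail_image dhead_image !UE fd0 incident_face.
    exact: incident_head.
  rewrite xE; case: (eqVneq (x (f (dart_image autp d0))) (X w)) => [-> neq|].
    exists (f (drev (dart_image autp d0))).
    by move: neq; do 2!case: (X w); case: (x _).
  by exists (f (dart_image autp d0)).
have onU v : incident v F' -> v \in U.
  move=> vF'; apply: contraT => offv; case/eqP: xF'; rewrite (XE v F' offv vF').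
  apply: (connect_invariant _ (connU _ _ offv offw)) => u u' /and3P[offu offu'].
  case/dart_of_edge=> d [td hd].
  have uF : incident u (f d) by rewrite -td incident_face.
  have uF' : incident u' (f d) by rewrite -hd incident_head.
  exact: etrans (esym (XE u _ offu uF)) (XE u' _ offu' uF').
exists F' => v; apply/idP/idP => [/onU|]; first by rewrite UE.
(* [rho d] leads off [F], hence its image leads off [U] and thus off [F'], so
   that the image of [d] has to stay on [F']. *)
have step d : f d = F -> incident (p (dtail d)) F' -> incident (p (dhead d)) F'.
  move=> fd /incidentP[c tc fc].
  have offr : dhead (dart_image autp (rho d)) \notin U.
    by rewrite dhead_image UE -fd; have := spoke_off d; rewrite inE.
  have third : dart_image autp (rho d) = rho c.
    have tr : dtail (dart_image autp (rho d)) = dtail c.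
      by rewrite dtail_image dtail_rot tc.
    case: (same_tail rho cubG tr) => // eq_c; case/negP: offr; apply: onU.
      by rewrite eq_c -fc incident_head.
    by rewrite eq_c -fc; have := back_on c; rewrite inE.
  have td : dtail (dart_image autp d) = dtail c by rewrite dtail_image tc.
  rewrite -(dhead_image autp); case: (same_tail rho cubG td) => eq_c.
  - by rewrite eq_c -fc incident_head.
  - have /eqP[] := rot_neq rho cubG d; apply: (@dart_image_inj _ _ autp).
    by rewrite third.
  - by rewrite eq_c -fc; have := back_on c; rewrite inE.
have [c fc] := face_of_surj F'.
have cF' : incident (dtail c) F' by rewrite fc incident_face.
have /imsetP[u] := onU _ cF'; rewrite inE => /incidentP[d du fd] cu.
case/incidentP=> d' <- fd'; have : f d = f d' by rewrite fd'.
case/face_of_iter=> n ->; elim: n => [|n IHn] /=.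
  by rewrite du -cu.
rewrite face_perm_rev dtail_rot dtail_rev; apply: step => //.
by rewrite face_of_iterE.
Qed.

Lemma dual_aut_of_graph_aut p :
  p \in graph_aut G -> exists q, incidence_iso p q.
Proof.
move=> autp; have [q qE] := fin_all_exists (face_image autp).
have q_inj : injective q.
  by move=> F F' eq_q; apply: incident_face_inj => v; rewrite -qE eq_q qE.
by exists (perm q_inj) => v F; rewrite permE qE.
Qed.

(** * Facial cycles determine the signature *)

Section Faces.
Variable lam : signature G.
Local Notation step := (face_step rho lam).
Local Open Scope nat_scope.

Lemma face_stepE d b : let c := b (+) lam (edge_of d) in
  step (d, b) = (if c then rho (rho (drev d)) else rho (drev d), c).
Proof. by rewrite /face_step /= rotV. Qed.

Lemma face_step_inj : injective step.
Proof.
move=> [d b] [d' b']; rewrite !face_stepE.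
set c := b (+) _; set c' := b' (+) _ => -[eq_d eq_c].
have {}eq_d : d = d'.
  move: eq_d; rewrite -eq_c; case: c {eq_c} => [|] => [/perm_inj/perm_inj|/perm_inj];
  exact: (can_inj (@drevK G)).
by move: eq_c; rewrite /c /c' eq_d => /addIb->.
Qed.

(** The state before [s]: the last crossing switched the sense of rotation iff
    the edge crossed is twisted. *)
Definition face_prev (s : dart G * bool) : dart G * bool :=
  let d := drev (if s.2 then rho s.1 else rho (rho s.1)) in
  (d, s.2 (+) lam (edge_of d)).

Lemma face_prevK s : step (face_prev s) = s.
Proof.
case: s => d b; rewrite /face_prev face_stepE /= addbK drevK.
by case: b; rewrite (rot3 rho cubG).
Qed.

Definition face_cycle x : {set {set G}} := [set edge_of d | d in facial_walk rho lam x].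

Lemma face_cycleP x e :
  reflect (exists2 s, fconnect step x s & e = edge_of s.1) (e \in face_cycle x).
Proof.
apply: (iffP imsetP) => [[d /mapP[s]]|[s xs ->]].
  by rewrite -fconnect_orbit => xs -> ->; exists s.
by exists s.1 => //; apply: map_f; rewrite -fconnect_orbit.
Qed.

Lemma face_cycle_in x s : fconnect step x s -> edge_of s.1 \in face_cycle x.
Proof. by move=> xs; apply/face_cycleP; exists s. Qed.

Lemma face_cycle_next x s :
  fconnect step x s -> edge_of (step s).1 \in face_cycle x.
Proof.
by move=> xs; apply/face_cycle_in/(connect_trans xs)/fconnect1.
Qed.

Lemma face_cycle_prev x s :
  fconnect step x s -> edge_of (face_prev s).1 \in face_cycle x.
Proof.
move=> xs; apply/face_cycle_in/(connect_trans xs).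
by rewrite (fconnect_sym face_step_inj) -{2}[s]face_prevK fconnect1.
Qed.

(** A facial walk uses an edge at the tail of [d] either in the state that leaves
    this vertex or in the state before it.  The walk passes through the vertex
    only once, so there is just one state of each kind. *)
Lemma strong_two_edges x d : strong rho lam ->
  ~~ [&& edge_of d \in face_cycle x, edge_of (rho d) \in face_cycle x
       & edge_of (rho (rho d)) \in face_cycle x].
Proof.
move=> strong_lam; have /and3P[_ _ uniqw] := strong_lam x.
rewrite /facial_walk -map_comp in uniqw.
have tail_inj s s' : fconnect step x s -> fconnect step x s' ->
    dtail s.1 = dtail s'.1 -> s = s'.
  rewrite !fconnect_orbit => xs xs'; exact: (uniq_map_inj uniqw).
have ends c : dtail c = dtail d -> edge_of c \in face_cycle x ->
    exists2 s, fconnect step x s &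
      s.1 = c \/ s.1 = drev c /\ dtail (step s).1 = dtail d.
  move=> tc /face_cycleP[s xs /esym/eqP].
  rewrite edge_of_eq => /orP[]/eqP sc; exists s => //; [by left|right; split=> //].
  by rewrite (surjective_pairing s) face_stepE /=; case: ifP;
    rewrite !dtail_rot dtail_rev sc.
have t1 : dtail (rho d) = dtail d by rewrite dtail_rot.
have t2 : dtail (rho (rho d)) = dtail d by rewrite !dtail_rot.
have clash c c' s s' : dtail c = dtail d -> dtail c' = dtail d -> c != c' ->
    fconnect step x s -> fconnect step x s' ->
    s.1 = c /\ s'.1 = c' \/
    (s.1 = drev c /\ dtail (step s).1 = dtail d) /\
    (s'.1 = drev c' /\ dtail (step s').1 = dtail d) -> False.
  move=> tc tc' /eqP neq_c xs xs' [[sc sc']|[[sc ts] [sc' ts']]].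
    apply: neq_c; rewrite -sc -sc' (tail_inj s s') //.
    by rewrite sc sc' tc tc'.
  apply: neq_c; apply: (can_inj (@drevK G)); rewrite -sc -sc'.
  congr fst; apply: face_step_inj; apply: tail_inj; rewrite ?ts ?ts' //.
    exact: connect_trans xs (fconnect1 _ _).
  exact: connect_trans xs' (fconnect1 _ _).
apply/and3P=> -[/(ends _ erefl)[s0 x0 h0] /(ends _ t1)[s1 x1 h1] /(ends _ t2)[s2 x2 h2]].
have n01 : d != rho d by rewrite eq_sym rot_neq.
have n12 : rho d != rho (rho d) by rewrite eq_sym rot_neq.
have n02 : d != rho (rho d) by rewrite eq_sym rot2_neq.
have c01 := clash d _ s0 s1 erefl t1 n01 x0 x1.
have c12 := clash _ _ s1 s2 t1 t2 n12 x1 x2.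
have c02 := clash d _ s0 s2 erefl t2 n02 x0 x2.
tauto.
Qed.

End Faces.

(** The facial cycle of [lam'] through the corner before [d] takes one of the two
    other edges at the tail and one of the two at the head, and no more because
    [lam'] is strong.  A walk of [lam] along the same edges takes the same two, which
    forces the sign. *)
Lemma signature_of_facial_cycles (lam lam' : signature G) d :
    strong rho lam' -> facial_cycles rho lam = facial_cycles rho lam' ->
  lam (edge_of d) = lam' (edge_of d).
Proof.
move=> strong' eqFC; set e := edge_of d; apply/eqP; apply: contraT => neq_lam.
set C := face_cycle lam' (d, false).
have two c := @strong_two_edges lam' (d, false) c strong'.
have eC : e \in C by apply: (@face_cycle_in lam' _ (d, false)); apply: connect0.
have nextC := @face_cycle_next lam' (d, false) (d, false) (connect0 _ _).
have prevC := @face_cycle_prev lam' (d, false) (d, false) (connect0 _ _).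
have not_rot : edge_of (rho d) \notin C.
  have := two d; rewrite -/C eC /=; move: prevC; rewrite /= edge_of_rev -/C => ->.
  by rewrite andbT.
have not_across : edge_of (if lam' e then rho (drev d) else rho (rho (drev d))) \notin C.
  have := two (drev d); rewrite -/C edge_of_rev -/e eC /=.
  move: nextC; rewrite face_stepE /= -/e -/C.
  by case: (lam' e) => ->; rewrite ?andbT.
have : C \in facial_cycles rho lam by rewrite eqFC; apply: imset_f.
case/imsetP=> y _; rewrite -/(face_cycle lam y) => defC.
move: eC; rewrite defC => /face_cycleP[[d' b] ys /esym/eqP].
rewrite /= edge_of_eq => eq_d'.
have := face_cycle_next ys; have := face_cycle_prev ys.
rewrite -defC face_stepE /= edge_of_rev.
have -> : edge_of d' = e by apply/eqP; rewrite /e edge_of_eq.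
(* The walk of [lam] may cross the edge in either direction. *)
move: neq_lam not_across not_rot; case/orP: eq_d' => /eqP ->.
  case: b {ys} => /=; first by move=> _ _ /negPf->.
  by case: (lam e); case: (lam' e) => //= _ /negPf->.
rewrite drevK; case: b {ys}; case: (lam e); case: (lam' e) => //= _.
- by move=> _ /negPf->.
- by move=> /negPf->.
- by move=> /negPf->.
by move=> _ /negPf->.
Qed.

(** * Transport of facial cycles *)

(** The face whose corner the traversal has just turned; it says as much as the
    boolean of the state, but refers to no orientation. *)
Definition side (s : dart G * bool) : T := if s.2 then f (drev s.1) else f s.1.

(** Description of [face_step] by incidence: of the two darts at the head that do
    not turn back, exactly one has the required face beside it. *)
Lemma face_step_by_side lam s s' :
    dtail s'.1 = dhead s.1 -> s'.1 != drev s.1 ->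
    side s' = side (s.1, s.2 (+) lam (edge_of s.1)) ->
  face_step rho lam s = s'.
Proof.
case: s s' => [d b] [d' b'] /= td' neq_d'; rewrite face_stepE.
set c := b (+) _ => eq_side.
have third : f (rho (rho (drev d))) != side (d, c).
  rewrite /side /=; case: c {eq_side}; first by rewrite eq_sym face_rot2_neq.
  by rewrite -(face_of_step rho d) eq_sym face_rot_neq.
rewrite /side /= in third eq_side.
have [eq_d'|eq_d'|eq_d'] := same_tail rho cubG (td' : dtail d' = dtail (drev d));
  rewrite {}eq_d' in eq_side neq_d' *.
- by rewrite eqxx in neq_d'.
- case: b' eq_side => /= [|] eq_side.
    by rewrite -eq_side face_of_rev eqxx in third.
  rewrite face_of_step in eq_side; case: (c) eq_side => // eq_side.
  by have := face_rev_neq d; rewrite eq_side eqxx.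
case: b' eq_side => /= [|] eq_side; last first.
  by rewrite -eq_side eqxx in third.
rewrite face_rev_rot2 in eq_side; case: (c) eq_side => // eq_side.
by have := face_rev_neq d; rewrite eq_side eqxx.
Qed.

Lemma side_of_step lam s :
  side (face_step rho lam s) = side (s.1, s.2 (+) lam (edge_of s.1)).
Proof.
case: s => d b; rewrite face_stepE /side /=; case: (_ (+) _).
  by rewrite face_rev_rot2.
by rewrite face_of_step.
Qed.

Lemma step_tail lam s : dtail (face_step rho lam s).1 = dhead s.1.
Proof. by case: s => d b; rewrite face_stepE /=; case: ifP; rewrite !dtail_rot. Qed.

Lemma step_turns lam s : (face_step rho lam s).1 != drev s.1.
Proof.
by case: s => d b; rewrite face_stepE /=; case: ifP; rewrite ?rot2_neq ?rot_neq.
Qed.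

Lemma side_inj d b b' : side (d, b) = side (d, b') -> b = b'.
Proof.
by case: b b' => [] [] //=; rewrite /side /= => eq_s; case/eqP: (face_rev_neq d).
Qed.

Section Transport.
Variables (p : {perm G}) (q : {perm T}).
Hypotheses (iso_pq : incidence_iso p q) (autp : p \in graph_aut G).
Local Notation pd := (dart_image autp).

Lemma sides_image d :
  (q (f d) == f (pd d)) && (q (f (drev d)) == f (drev (pd d))) ||
  (q (f d) == f (drev (pd d))) && (q (f (drev d)) == f (pd d)).
Proof.
have sideq F : incident (dtail d) F && incident (dhead d) F ->
    (q F == f (pd d)) || (q F == f (drev (pd d))).
  by rewrite -incident_both_ends dtail_image dhead_image !iso_pq.
have := sideq (f d); rewrite incident_face incident_head => /(_ isT).
have := sideq (f (drev d)); rewrite incident_rev (incident_face (drev d)) => /(_ isT).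
have neq : q (f d) != q (f (drev d)) by rewrite (inj_eq perm_inj) face_rev_neq.
by case/orP=> /eqP eq1 /orP[]/eqP eq2; move: neq; rewrite eq1 eq2 !eqxx ?orbT.
Qed.

(** The boolean is adjusted so that [side] corresponds under [q]; it changes
    where [p] reverses the rotation. *)
Definition state_image (s : dart G * bool) : dart G * bool :=
  (pd s.1, s.2 (+) (q (f s.1) != f (pd s.1))).

Lemma side_image s : side (state_image s) = q (side s).
Proof.
case: s => d b; rewrite /state_image /side /= (fun_if q).
have neq := face_rev_neq (pd d).
have := sides_image d; case/orP=> /andP[/eqP-> /eqP->].
  by rewrite eqxx addbF.
by rewrite eq_sym neq addbT; case: b.
Qed.

Lemma state_image_inj : injective state_image.
Proof.
move=> [d b] [d' b'] eq_s.
have eq_d : d = d' by apply: (@dart_image_inj _ _ autp); exact: (congr1 fst eq_s).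
rewrite -{}eq_d in eq_s *; congr pair; apply: (@side_inj d).
by apply: (@perm_inj _ q); rewrite -!side_image eq_s.
Qed.

Variables lam1 lam2 : signature G.
Hypothesis lam12 : forall d, lam2 (p @: edge_of d) = lam1 (edge_of d).

Lemma state_image_step s :
  face_step rho lam2 (state_image s) = state_image (face_step rho lam1 s).
Proof.
apply: face_step_by_side.
- exact: (congr1 p (step_tail lam1 s)).
- by rewrite -(dart_image_rev autp) (inj_eq (@dart_image_inj _ _ autp)) step_turns.
rewrite side_image side_of_step -side_image /state_image /=.
by rewrite edge_of_image lam12 addbAC.
Qed.

Lemma face_cycle_image x :
  face_cycle lam2 (state_image x) =
  [set p @: (e : {set G}) | e in face_cycle lam1 x].
Proof.
have iter_image n : iter n (face_step rho lam2) (state_image x) =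
    state_image (iter n (face_step rho lam1) x).
  elim: n => [//|n IHn]; rewrite !iterS IHn; exact: state_image_step.
apply/setP=> e; apply/face_cycleP/imsetP => [[s /iter_findex <- ->]|[e']].
  rewrite iter_image edge_of_image; set s1 := iter _ _ x.
  by exists (edge_of s1.1) => //; apply: face_cycle_in; apply: fconnect_iter.
case/face_cycleP=> s /iter_findex <- -> ->; set n := findex _ _ _.
exists (iter n (face_step rho lam2) (state_image x)); first exact: fconnect_iter.
by rewrite iter_image edge_of_image.
Qed.

Lemma facial_cycles_image :
  facial_cycles rho lam2 =
  [set [set p @: (e : {set G}) | e in (C : {set {set G}})]
    | C in facial_cycles rho lam1].
Proof.
apply/setP=> C; apply/imsetP/imsetP => [[x _ ->]|[C' /imsetP[x _ ->] ->]].
  exists (face_cycle lam1 (invF state_image_inj x)); first exact: imset_f.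
  by rewrite -face_cycle_image f_invF.
by exists (state_image x) => //; rewrite -/(face_cycle lam1 x) -face_cycle_image.
Qed.

End Transport.

Lemma dual_edge_image p q (iso_pq : incidence_iso p q) d :
  dual_edge rho (p @: edge_of d) = q @: dual_edge rho (edge_of d).
Proof.
have autp := incidence_iso_graph_aut iso_pq.
rewrite -(edge_of_image autp) !dual_edge_of imsetU1 imset_set1.
have := sides_image iso_pq autp d; case/orP=> /andP[/eqP-> /eqP->] //.
by rewrite setUC.
Qed.

End Planar.

(** * Isomorphic embeddings and orbits *)

Lemma sub_verticesE (H : sgraph) (K : subgraph H) :
  no_isolated_vertex K -> sub_vertices K = cover (sub_edges K).
Proof.
move=> noiso; apply/setP=> v; apply/idP/bigcupP => [/noiso[e]|[e eK]]; first by exists e.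
by apply/subsetP/sub_edges_ends.
Qed.

Lemma same_aut_orbit_edges (H : sgraph) (K1 K2 : subgraph H) (q : {perm H}) :
    no_isolated_vertex K1 -> no_isolated_vertex K2 -> q \in graph_aut H ->
    sub_edges K2 = [set q @: (e : {set H}) | e in sub_edges K1] ->
  same_aut_orbit K1 K2.
Proof.
move=> iso1 iso2 autq eqK; exists q => //; split=> //.
rewrite !sub_verticesE // eqK; apply/setP=> v; apply/bigcupP/imsetP.
  case=> _ /imsetP[e eK ->] /imsetP[u ue ->].
  by exists u => //; apply/bigcupP; exists e.
case=> u /bigcupP[e eK ue] ->; exists (q @: e); last exact: imset_f.
exact: imset_f.
Qed.

Theorem lemma3p6 (G : sgraph) (rho : rotation_system G)
    (H1 H2 : subgraph (dual_graph rho)) :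
  k_connected G 3 -> cubic G -> spherical rho ->
  no_isolated_vertex H1 -> no_isolated_vertex H2 ->
  strong rho (induced_signature H1) ->
  strong rho (induced_signature H2) ->
  (isomorphic_embeddings rho (induced_signature H1)
                         rho (induced_signature H2)
   <-> same_aut_orbit H1 H2).
Proof.
move=> conn3 cubG sphG iso1 iso2 _ strong2.
split=> [[p autp eqFC] | [q autq [_ eqH]]]; last first.
  have [p iso_pq] := graph_aut_of_dual_aut conn3 cubG sphG autq.
  have autp := incidence_iso_graph_aut conn3 cubG sphG iso_pq.
  exists p => //; apply: (facial_cycles_image conn3 cubG sphG iso_pq autp) => d.
  rewrite /induced_signature (dual_edge_image conn3 cubG sphG iso_pq) eqH.
  by rewrite mem_imset //; apply/imset_inj/perm_inj.
have [q iso_pq] := dual_aut_of_graph_aut conn3 cubG sphG autp.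
have autq := incidence_iso_dual_aut conn3 cubG sphG iso_pq.
(* The image of the first signature; it has the same facial cycles as the
   second, hence agrees with it. *)
pose lam (e : {set G}) := induced_signature H1 (p^-1%g @: e).
have lamE d : lam (p @: edge_of d) = induced_signature H1 (edge_of d).
  congr (induced_signature H1 _); rewrite -imset_comp -[RHS]imset_id.
  by apply: eq_imset => v /=; rewrite permK.
have sigE d : induced_signature H2 (p @: edge_of d) = induced_signature H1 (edge_of d).
  rewrite -lamE -(edge_of_image autp); symmetry.
  apply: (signature_of_facial_cycles cubG _ strong2).
  by rewrite eqFC; apply: (facial_cycles_image conn3 cubG sphG iso_pq autp).
apply: same_aut_orbit_edges iso1 iso2 autq _.
have dual_edgeP (K : subgraph (dual_graph rho)) E :
    E \in sub_edges K -> exists d : dart G, E = dual_edge rho (edge_of d).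
  move=> /(subsetP (sub_edges_in K))/edgeP[D ->].
  have /dual_adjP[_ [d fd frd]] := dart_edge D.
  by exists d; rewrite dual_edge_of fd frd.
apply/setP=> E; apply/idP/imsetP => [EH2|[E1 E1H1 ->]].
  have [d defE] := dual_edgeP _ _ EH2.
  pose d' := invF (dart_image_inj (autp := autp)) d.
  have defd : edge_of d = p @: edge_of d' by rewrite -(edge_of_image autp) f_invF.
  exists (dual_edge rho (edge_of d')).
    by rewrite -[_ \in _]sigE -defd /induced_signature -defE.
  by rewrite defE defd (dual_edge_image conn3 cubG sphG iso_pq).
have [d defE] := dual_edgeP _ _ E1H1.
rewrite defE -(dual_edge_image conn3 cubG sphG iso_pq).
by rewrite -[_ \in _]/(induced_signature H2 _) sigE /induced_signature -defE.
Qed.
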